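(* Let $K=\mathbb{F}_q((t))$ be the field of formal Laurent series over the finite field $\mathbb{F}_q$, with its $t$-adic valuation, and let $\mathcal{L}_t$ be the language of rings with a constant symbol for $t$. Then the Grothendieck ring $K_0(K)$ of $(K,\mathcal{L}_t)$ is trivial, and there is an $\mathcal{L}_t$-definable bijection from $R$ to $R^*=R\setminus\{0\}$, where $R=\mathbb{F}_q[[t]]$ is the valuation ring.
   Context: The Grothendieck ring $K_0(K)$ of a structure is the quotient of the free abelian group on classes of definable subsets of the $K^n$ ($n\ge1$) modulo definable bijection (bijection with definable graph), by the relations $\lfloor X\rfloor+\lfloor Y\rfloor=\lfloor X\cup Y\rfloor+\lfloor X\cap Y\rfloor$, with multiplication induced by Cartesian product. Definable means definable in $(K,\mathcal{L}_t)$.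
   Formalization: The Grothendieck ring is defined with the additional relation that the class of the empty set is 0; with only the union–intersection relations, sending every class to 1 is a ring morphism onto the integers, so the ring would never be trivial. *)

(* Defs.v *)
From HB Require Import structures.
From mathcomp Require Import all_boot all_order all_algebra.
From mathcomp Require Import generic_quotient ring_quotient.
From mathcomp Require Import zify.
From mathcomp Require Import boolp classical_sets functions fsbigop.
From mathcomp Require Import finmap monalg.

Set Implicit Arguments.
Unset Strict Implicit.
Unset Printing Implicit Defensive.
Import Order.TTheory GRing.Theory Num.Theory.
Local Open Scope classical_set_scope.
Local Open Scope ring_scope.
Local Open Scope quotient_scope.

(* Formal Laurent series: the coefficients indexed by int vanish below some
   index. *)
Record laurent (F : nzRingType) := Laurent {
  lcoef : int -> F;
  lcoef_bounded : exists m : int, forall n, n < m -> lcoef n = 0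
}.

Section LaurentSeries.
Variable F : fieldType.
Local Notation L := (laurent F).
Implicit Types f g h : L.

HB.instance Definition _ := gen_eqMixin L.
HB.instance Definition _ := gen_choiceMixin L.

Lemma laurentP f g : (forall n, lcoef f n = lcoef g n) -> f = g.
Proof.
case: f g => [f bf] [g bg] /= /funext fg; rewrite {}fg in bf *.
by rewrite (Prop_irrelevance bf bg).
Qed.

Local Notation vanish_below f m := (forall n : int, n < m -> lcoef f n = 0).

Fact lzero_bounded : exists m : int, forall n : int, n < m -> (0 : F) = 0.
Proof. by exists 0. Qed.
Definition lzero := Laurent lzero_bounded.

Fact lopp_bounded f :
  exists m : int, forall n, n < m -> - lcoef f n = 0.
Proof. by have [m fm] := lcoef_bounded f; exists m => n /fm ->; rewrite oppr0. Qed.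
Definition lopp f := Laurent (lopp_bounded f).

Lemma common_bound f g : exists m : int, vanish_below f m /\ vanish_below g m.
Proof.
have [m fm] := lcoef_bounded f; have [k gk] := lcoef_bounded g.
by exists (Num.min m k); split=> n; rewrite lt_min => /andP[? ?]; auto.
Qed.

Fact ladd_bounded f g :
  exists m : int, forall n, n < m -> lcoef f n + lcoef g n = 0.
Proof.
have [m [fm gm]] := common_bound f g.
by exists m => n nm; rewrite fm ?gm ?addr0.
Qed.
Definition ladd f g := Laurent (ladd_bounded f g).

Fact lmonom_bounded (d : int) :
  exists m : int, forall n, n < m -> (n == d)%:R = 0 :> F.
Proof. by exists d => n; rewrite lt_neqAle => /andP[/negPf->]. Qed.
Definition lmonom (d : int) := Laurent (lmonom_bounded d).

(* The support of the summand is finite since f and g are bounded below. *)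
Definition lmul_coef f g (n : int) : F :=
  \sum_(i \in [set: int]) lcoef f i * lcoef g (n - i).

Lemma lmul_coef_below f g m k (n : int) :
    vanish_below f m -> vanish_below g k ->
  n < m + k -> lmul_coef f g n = 0.
Proof.
move=> fm gk nmk; apply: fsbig1 => i _.
have [/fm ->|mi] := ltP i m; first by rewrite mul0r.
by rewrite gk ?mulr0 // ltrBlDl (lt_le_trans nmk) // lerD2r.
Qed.

Lemma lmul_coefE f g m k d :
    vanish_below f m -> vanish_below g k ->
  lmul_coef f g (m + k + d%:Z) =
  \sum_(i < d.+1) lcoef f (m + i%:Z) * lcoef g (k + (d - i)%N%:Z).
Proof.
move=> fm gk; pose r := [seq m + i%:Z | i <- iota 0 d.+1].
have ur : uniq r by rewrite map_inj_uniq ?iota_uniq // => i j; lia.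
rewrite /lmul_coef (fsbigE r) //; last first.
  move=> i _ nir; have [/fm ->|mi] := ltP i m; first by rewrite mul0r.
  rewrite gk ?mulr0 // ltNge; apply: contra nir => nir.
  apply/mapP; exists `|i - m|%N; last by lia.
  by rewrite mem_iota; lia.
rewrite (eq_bigl xpredT) => [|i]; last by rewrite in_setT.
rewrite big_map -[iota _ _]/(index_iota 0 d.+1) big_mkord.
apply: eq_bigr => i _; congr (_ * lcoef g _).
by have := ltn_ord i; lia.
Qed.

Fact lmul_bounded f g :
  exists m : int, forall n, n < m -> lmul_coef f g n = 0.
Proof.
have [m fm] := lcoef_bounded f; have [k gk] := lcoef_bounded g.
by exists (m + k) => n; exact: lmul_coef_below.
Qed.
Definition lmul f g := Laurent (lmul_bounded f g).

Lemma laurent_ext m f g : vanish_below f m -> vanish_below g m ->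
  (forall d : nat, lcoef f (m + d%:Z) = lcoef g (m + d%:Z)) -> f = g.
Proof.
move=> fm gm fg; apply: laurentP => n; have [nm|mn] := ltP n m.
  by rewrite fm ?gm.
have -> : n = m + `|n - m|%N%:Z by lia.
exact: fg.
Qed.

Let trunc f m N : {poly F} := \poly_(i < N) lcoef f (m + i%:Z).

Let lmul_trunc f g m k d N : vanish_below f m -> vanish_below g k ->
  (d < N)%N -> lcoef (lmul f g) (m + k + d%:Z) = (trunc f m N * trunc g k N)`_d.
Proof.
move=> fm gk dN; rewrite /= (lmul_coefE _ fm gk) coefM.
apply: eq_bigr => i _; have := ltn_ord i => id.
by rewrite !coef_poly !ifT //; lia.
Qed.

Fact laddA : associative ladd.
Proof. by move=> f g h; apply: laurentP => n /=; rewrite addrA. Qed.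
Fact laddC : commutative ladd.
Proof. by move=> f g; apply: laurentP => n /=; rewrite addrC. Qed.
Fact ladd0 : left_id lzero ladd.
Proof. by move=> f; apply: laurentP => n /=; rewrite add0r. Qed.
Fact laddN : left_inverse lzero lopp ladd.
Proof. by move=> f; apply: laurentP => n /=; rewrite addNr. Qed.

HB.instance Definition _ :=
  GRing.isZmodule.Build L laddA laddC ladd0 laddN.

Fact lmulC : commutative lmul.
Proof.
move=> f g; have [m [fm gm]] := common_bound f g.
apply: (@laurent_ext (m + m)) => [n|n|d]; try exact: lmul_coef_below.
by rewrite !(@lmul_trunc _ _ _ _ _ d.+1) // mulrC.
Qed.

Fact lmulA : associative lmul.
Proof.
move=> f g h.
have [m fm] := lcoef_bounded f; have [k gk] := lcoef_bounded g.
have [l hl] := lcoef_bounded h.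
have ghkl : vanish_below (lmul g h) (k + l) by move=> n; exact: lmul_coef_below.
have fgmk : vanish_below (lmul f g) (m + k) by move=> n; exact: lmul_coef_below.
apply: (@laurent_ext (m + k + l)) => [n|n|d].
- by rewrite -addrA; exact: lmul_coef_below.
- exact: lmul_coef_below.
rewrite (lmul_trunc fgmk hl (ltnSn d)) -(addrA m) (lmul_trunc fm ghkl (ltnSn d)).
have tE (p v : {poly F}) u c :
    (forall i, (i < d.+1)%N -> lcoef u (c + i%:Z) = v`_i) ->
    (p * trunc u c d.+1)`_d = (p * v)`_d.
  move=> uv; rewrite !coefM; apply: eq_bigr => i _.
  by rewrite coef_poly !ifT ?uv //; lia.
rewrite (tE _ (trunc g k d.+1 * trunc h l d.+1)); last first.
  by move=> i id; exact: lmul_trunc.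
rewrite [in RHS]mulrC (tE _ (trunc f m d.+1 * trunc g k d.+1)); last first.
  by move=> i id; exact: lmul_trunc.
by rewrite mulrA [in RHS]mulrC.
Qed.

Fact lmul1 : left_id (lmonom 0) lmul.
Proof.
move=> f; apply: laurentP => n /=; rewrite /lmul_coef (fsbigE [:: 0]) //=.
  by rewrite big_cons big_nil in_setT /= mul1r subr0 addr0.
by move=> i _; rewrite inE => /negPf->; rewrite mul0r.
Qed.

Fact lmulD : left_distributive lmul ladd.
Proof.
move=> f g h; have [m [fm gm]] := common_bound f g.
have [k hk] := lcoef_bounded h.
have fgm : vanish_below (ladd f g) m by move=> n nm /=; rewrite fm ?gm ?addr0.
apply: (@laurent_ext (m + k)) => [n|n nmk|d] /=; first exact: lmul_coef_below.
  by rewrite (lmul_coef_below fm hk) // (lmul_coef_below gm hk) // addr0.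
rewrite (lmul_coefE _ fgm hk) (lmul_coefE _ fm hk) (lmul_coefE _ gm hk).
by rewrite -big_split; apply: eq_bigr => i _; rewrite mulrDl.
Qed.

Fact lone_neq0 : lmonom 0 != lzero.
Proof.
by apply/eqP => /(congr1 (fun f => lcoef f 0)) /= /eqP; rewrite oner_eq0.
Qed.

HB.instance Definition _ :=
  GRing.Zmodule_isComNzRing.Build L lmulA lmulC lmul1 lmulD lone_neq0.

Section Inverse.
Variable a : nat -> F.

Fixpoint inv_prefix (n : nat) : seq F :=
  if n is n'.+1 then
    let s := inv_prefix n' in
    rcons s ((a 0)^-1 * ((n' == 0)%:R - \sum_(i < n') a (n' - i)%N * s`_i))
  else [::].

Let b n := (inv_prefix n.+1)`_n.

Let size_inv_prefix n : size (inv_prefix n) = n.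
Proof. by elim: n => //= n IHn; rewrite size_rcons IHn. Qed.

Let inv_prefixE n i : (i < n)%N -> (inv_prefix n)`_i = b i.
Proof.
elim: n => // n IHn; rewrite ltnS leq_eqVlt => /predU1P[->//|lt_in].
by rewrite /= nth_rcons size_inv_prefix lt_in IHn.
Qed.

Lemma powerseries_inv : a 0 != 0 ->
  exists b : nat -> F, forall n, \sum_(i < n.+1) a i * b (n - i)%N = (n == 0)%:R.
Proof.
move=> a0; exists b => n; rewrite (reindex_inj rev_ord_inj) /=.
under eq_bigr => i _ do rewrite subSS subKn -1?ltnS //.
rewrite big_ord_recr /= subnn {2}/b /= nth_rcons size_inv_prefix ltnn eqxx.
rewrite mulVKf // addrC.
under [X in _ - X]eq_bigr => i _ do rewrite inv_prefixE //.
by rewrite subrK.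
Qed.
End Inverse.

Fact laurent_unit f : f != 0 -> exists g, g * f = 1.
Proof.
move=> f0; have [m fm] := lcoef_bounded f.
have [k fk] : exists k : nat, lcoef f (m + k%:Z) != 0.
  apply: contrapT => /forallNP fk; move/eqP: f0; apply.
  by apply: (@laurent_ext m) => // d; have /negP := fk d; rewrite negbK => /eqP ->.
pose P k := lcoef f (m + k%:Z) != 0.
have exP : exists k, P k by exists k.
case: (ex_minnP exP) => {fk}k fk mink; rewrite /P in fk.
pose v := m + k%:Z; have {}fm : vanish_below f v.
  move=> n nv; have [/fm//|mn] := ltP n m.
  have ne : n = m + `|n - m|%N%:Z by lia.
  apply/eqP/negPn/negP => fn; have := mink `|n - m|%N.
  by rewrite /P -ne => /(_ fn); lia.
have [|b bP] := @powerseries_inv (fun i => lcoef f (v + i%:Z)).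
  by rewrite addr0.
pose c (n : int) : F := if 0 <= n + v then b (absz (n + v)) else 0.
have cv : (forall n : int, n < - v -> c n = 0).
  by move=> n nv; rewrite /c ifF //; lia.
pose g := Laurent (ex_intro _ (- v) cv); exists g.
have gv : vanish_below g (- v) by exact: cv.
rewrite [g * f]mulrC; apply: (@laurent_ext (v - v)) => [n|n|d].
- exact: lmul_coef_below.
- by rewrite subrr => n0; rewrite -[1]/(lmonom 0) /= lt_eqF.
rewrite /= (lmul_coefE _ fm gv) subrr add0r -[RHS]bP.
apply: eq_bigr => i _; congr (_ * _).
by rewrite /g /c /=; have -> : - v + (d - i)%N%:Z + v = (d - i)%N%:Z by lia.
Qed.

Definition linv f : L :=
  if pselect (f != 0) is left f0 then projT1 (cid (laurent_unit f0)) else 0.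

Fact lmulV f : f != 0 -> linv f * f = 1.
Proof. by rewrite /linv; case: pselect => // f0 _; case: cid. Qed.

Fact linv0 : linv 0 = 0.
Proof. by rewrite /linv; case: pselect => // f0; have := f0; rewrite eqxx. Qed.

HB.instance Definition _ := GRing.ComNzRing_isField.Build L lmulV linv0.

Definition laurent_t : L := lmonom 1.

(* The valuation ring F[[t]]: the series of nonnegative t-adic valuation. *)
Definition valring : set L := [set f | forall n : int, n < 0 -> lcoef f n = 0].

End LaurentSeries.

Arguments laurent_t F : clear implicits.
Arguments valring F : clear implicits.

(* First-order formulas, without parameters, over the language of rings with a
   constant symbol Tt, in n free variables. The variable bound by FExists is
   the variable 0 of its body. *)
Inductive Lt_term (n : nat) : Type :=
| TVar of 'I_n
| TZero
| TOne
| Tt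
| TOpp of Lt_term n
| TAdd of Lt_term n & Lt_term n
| TMul of Lt_term n & Lt_term n.

Inductive Lt_formula (n : nat) : Type :=
| FEq of Lt_term n & Lt_term n
| FNot of Lt_formula n
| FAnd of Lt_formula n & Lt_formula n
| FExists of Lt_formula n.+1.

Arguments TZero {n}.
Arguments TOne {n}.
Arguments Tt {n}.

Section Definability.
Variables (K : comNzRingType) (t : K).

Fixpoint Lt_eval n (x : 'rV[K]_n) (s : Lt_term n) : K :=
  match s with
  | TVar i => x 0 i
  | TZero => 0
  | TOne => 1
  | Tt => t
  | TOpp s1 => - Lt_eval x s1
  | TAdd s1 s2 => Lt_eval x s1 + Lt_eval x s2
  | TMul s1 s2 => Lt_eval x s1 * Lt_eval x s2
  end.

Fixpoint Lt_sat n (phi : Lt_formula n) : 'rV[K]_n -> Prop :=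
  match phi with
  | FEq s1 s2 => fun x => Lt_eval x s1 = Lt_eval x s2
  | FNot phi1 => fun x => ~ Lt_sat phi1 x
  | FAnd phi1 phi2 => fun x => Lt_sat phi1 x /\ Lt_sat phi2 x
  | FExists phi1 => fun x =>
      exists y : K, Lt_sat phi1 (row_mx (const_mx y : 'rV_1) x)
  end.

(* Points of K^n are row vectors. *)
Definition definable n (X : set 'rV[K]_n) :=
  exists phi : Lt_formula n, X = [set x | Lt_sat phi x].

(* Only the values of f on X matter, including in its graph. *)
Definition definable_bijection n m (X : set 'rV[K]_n) (Y : set 'rV[K]_m)
    (f : 'rV[K]_n -> 'rV[K]_m) :=
  set_bij X Y f /\ definable [set row_mx x (f x) | x in X].

Definition definably_bijective n m (X : set 'rV[K]_n) (Y : set 'rV[K]_m) :=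
  exists f, definable_bijection X Y f.

Lemma definableC n (X : set 'rV[K]_n) : definable X -> definable (~` X).
Proof. by move=> [phi ->]; exists (FNot phi). Qed.

Lemma definableI n (X Y : set 'rV[K]_n) :
  definable X -> definable Y -> definable (X `&` Y).
Proof. by move=> [phi ->] [psi ->]; exists (FAnd phi psi). Qed.

Lemma definableU n (X Y : set 'rV[K]_n) :
  definable X -> definable Y -> definable (X `|` Y).
Proof.
move=> dX dY; rewrite -[_ `|` _]setCK setCU.
by apply/definableC/definableI; exact: definableC.
Qed.

Lemma definableT n : definable (@setT 'rV[K]_n).
Proof. by exists (FEq TZero TZero); apply/seteqP; split. Qed.

Lemma definable0 n : definable (@set0 'rV[K]_n).
Proof. by rewrite -setCT; exact/definableC/definableT. Qed.

Definition lift_ren n m (r : 'I_n -> 'I_m) (i : 'I_n.+1) : 'I_m.+1 :=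
  match fintype.split (i : 'I_(1 + n)) with
  | inl j => @lshift 1 m j
  | inr j => @rshift 1 m (r j)
  end.

Fixpoint Lt_term_ren n m (r : 'I_n -> 'I_m) (s : Lt_term n) : Lt_term m :=
  match s with
  | TVar i => TVar (r i)
  | TZero => TZero
  | TOne => TOne
  | Tt => Tt
  | TOpp s1 => TOpp (Lt_term_ren r s1)
  | TAdd s1 s2 => TAdd (Lt_term_ren r s1) (Lt_term_ren r s2)
  | TMul s1 s2 => TMul (Lt_term_ren r s1) (Lt_term_ren r s2)
  end.

Fixpoint Lt_ren n (phi : Lt_formula n) m (r : 'I_n -> 'I_m) : Lt_formula m :=
  match phi with
  | FEq s1 s2 => FEq (Lt_term_ren r s1) (Lt_term_ren r s2)
  | FNot phi1 => FNot (Lt_ren phi1 r)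
  | FAnd phi1 phi2 => FAnd (Lt_ren phi1 r) (Lt_ren phi2 r)
  | FExists phi1 => FExists (Lt_ren phi1 (lift_ren r))
  end.

Lemma Lt_eval_ren n m (r : 'I_n -> 'I_m) (x : 'rV_m) s :
  Lt_eval x (Lt_term_ren r s) = Lt_eval (colsub r x) s.
Proof.
by elim: s => [i||||s1 IH|s1 IH s2 IH'|s1 IH s2 IH'] /=; rewrite ?mxE ?IH ?IH'.
Qed.

Lemma Lt_sat_ren n (phi : Lt_formula n) m (r : 'I_n -> 'I_m) (x : 'rV_m) :
  Lt_sat (Lt_ren phi r) x = Lt_sat phi (colsub r x).
Proof.
elim: n / phi m r x => [k s1 s2|k phi IH|k phi IH psi IH'|k phi IH] m r x /=.
- by rewrite !Lt_eval_ren.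
- by rewrite IH.
- by rewrite IH IH'.
suff E (y : K) : colsub (lift_ren r) (row_mx (const_mx y : 'rV_1) x) =
                 row_mx (const_mx y : 'rV_1) (colsub r x).
  by apply/propext; split=> -[y]; exists y; rewrite ?IH ?E // -E -IH.
apply/rowP => i; rewrite mxE /lift_ren [RHS]mxE.
case: fintype.splitP => j _.
- by rewrite (@row_mxEl _ _ 1 m) !mxE.
- by rewrite (@row_mxEr _ _ 1 m) mxE.
Qed.

Lemma definable_colsub n m (r : 'I_n -> 'I_m) (X : set 'rV[K]_n) :
  definable X -> definable [set x : 'rV_m | X (colsub r x)].
Proof.
move=> [phi ->]; exists (Lt_ren phi r).
by apply/seteqP; split=> x /=; rewrite Lt_sat_ren.
Qed.

Lemma definable_exists k : forall n (X : set 'rV[K]_(k + n)),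
  definable X -> definable [set x : 'rV_n | exists y : 'rV_k, X (row_mx y x)].
Proof.
elim: k => [|k IH] n X dX.
  suff -> : [set x : 'rV_n | exists y : 'rV_0, X (row_mx y x)] = X by [].
  have E (y : 'rV[K]_0) (x : 'rV_n) : row_mx y x = x.
    apply/rowP => i; rewrite mxE; case: fintype.splitP => [[]//|j /val_inj ij].
    by rewrite [in RHS]ij.
  apply/seteqP; split => x /=; first by move=> [y]; rewrite E.
  by exists 0; rewrite E.
have [phi E] := dX.
pose X' : set 'rV[K]_(k + n) :=
  [set x | exists y : K, Lt_sat phi (row_mx (const_mx y : 'rV_1) x)].
have dX' : definable X' by exists (FExists phi).
have rE (a : 'rV[K]_1) (b : 'rV[K]_k) (x : 'rV_n) :
    row_mx a (row_mx b x) = row_mx (row_mx a b) x :> 'rV_(1 + (k + n)).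
  by rewrite row_mxA castmx_id.
have := IH _ _ dX'; congr definable; apply/seteqP; split => x /=; rewrite E /=.
  by move=> [b [a]]; rewrite rE; exists (row_mx (const_mx a : 'rV_1) b).
move=> [y]; rewrite -[y](@hsubmxK _ _ 1 k) -rE => Xy.
exists (@rsubmx _ _ 1 k y), (@lsubmx _ _ 1 k y 0 0).
by rewrite (_ : const_mx _ = @lsubmx _ _ 1 k y) //; apply/rowP => i; rewrite mxE (ord1 i).
Qed.

Lemma definable_forall n m (X : 'I_m -> set 'rV[K]_n) :
  (forall i, definable (X i)) -> definable [set x | forall i, X i x].
Proof.
move=> dX; suff: forall s : seq 'I_m,
    definable [set x : 'rV_n | {in s, forall i, X i x}].
  move=> /(_ (enum 'I_m)); congr definable; apply/seteqP; split=> x xX i /=.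
    by apply: xX; rewrite mem_enum.
  by move=> _; exact: xX.
elim=> [|i s IH].
  rewrite (_ : [set _ | _] = setT); first exact: definableT.
  by apply/seteqP; split.
have := definableI (dX i) IH; congr definable; apply/seteqP; split=> x /=.
  by move=> [xi xs] j; rewrite inE => /predU1P[->|/xs].
by move=> xE; split=> [|j js]; apply: xE; rewrite inE ?eqxx ?js ?orbT.
Qed.

Lemma definable_eqcols n m (r1 r2 : 'I_n -> 'I_m) :
  definable [set x : 'rV_m | colsub r1 x = colsub r2 x].
Proof.
have := @definable_forall m n (fun i => [set x | x 0 (r1 i) = x 0 (r2 i)]).
rewrite (_ : [set _ | _] = [set x | colsub r1 x = colsub r2 x]).
  by apply=> i; exists (FEq (TVar (r1 i)) (TVar (r2 i))).
apply/seteqP; split=> x /= E; first by apply/rowP => i; rewrite !mxE.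
by move=> i; move/rowP: E => /(_ i); rewrite !mxE.
Qed.

Lemma definable_zero n : definable [set 0 : 'rV[K]_n].
Proof.
have := @definable_forall n n (fun i => [set x | x 0 i = 0]).
rewrite (_ : [set _ | _] = [set 0]).
  by apply=> i; exists (FEq (TVar i) TZero).
apply/seteqP; split=> x /=; first by move=> x0; apply/rowP => i; rewrite mxE.
by move=> -> i; rewrite mxE.
Qed.

Definition cartesian n m (X : set 'rV[K]_n) (Y : set 'rV[K]_m) :
  set 'rV[K]_(n + m) := [set row_mx x y | x in X & y in Y].

Lemma cartesianE n m (X : set 'rV[K]_n) (Y : set 'rV[K]_m) :
  cartesian X Y = [set z | X (lsubmx z) /\ Y (rsubmx z)].
Proof.
apply/seteqP; split=> z /=.
  by move=> [x Xx [y Yy <-]]; rewrite row_mxKl row_mxKr.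
by move=> [Xz Yz]; exists (lsubmx z) => //; exists (rsubmx z) => //; rewrite hsubmxK.
Qed.

Lemma definable_cartesian n m (X : set 'rV[K]_n) (Y : set 'rV[K]_m) :
  definable X -> definable Y -> definable (cartesian X Y).
Proof.
move=> /(definable_colsub (@lshift n m)) dX /(definable_colsub (@rshift n m)) dY.
have := definableI dX dY; congr definable; rewrite cartesianE.
by apply/seteqP; split=> z /=; rewrite lsubmxEsub rsubmxEsub.
Qed.

(* Binary relations on K^n x K^m, used below for the graphs of bijections. *)
Definition graph_definable n m (G : 'rV[K]_n -> 'rV[K]_m -> Prop) :=
  definable [set z : 'rV_(n + m) | G (lsubmx z) (rsubmx z)].

Definition bijective_graph n m (X : set 'rV[K]_n) (Y : set 'rV[K]_m)
    (G : 'rV[K]_n -> 'rV[K]_m -> Prop) :=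
  [/\ forall x y, G x y -> X x /\ Y y,
      forall x, X x -> exists y, G x y,
      forall y, Y y -> exists x, G x y,
      forall x y y', G x y -> G x y' -> y = y' &
      forall x x' y, G x y -> G x' y -> x = x'].

Lemma definably_bijectiveP n m (X : set 'rV[K]_n) (Y : set 'rV[K]_m) :
  definably_bijective X Y <-> exists G, graph_definable G /\ bijective_graph X Y G.
Proof.
split=> [[f [[fXY finj fsurj] df]]|[G [dG [GXY GX GY Gfun Ginj]]]].
  exists (fun x y => X x /\ f x = y); split.
    move: df; congr definable; apply/seteqP; split=> z /=.
      by move=> [x Xx <-]; rewrite row_mxKl row_mxKr.
    by move=> [Xz fz]; exists (lsubmx z) => //; rewrite fz hsubmxK.
  split.
  - by move=> x y [Xx <-]; split=> //; exact: fXY.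
  - by move=> x Xx; exists (f x).
  - by move=> y /fsurj[x Xx <-]; exists x.
  - by move=> x y y' [_ <-] [].
  - by move=> x x' y [Xx <-] [Xx' E]; apply: finj => //; exact: mem_set.
have [f fP] : {f : 'rV[K]_n -> 'rV[K]_m & forall x, X x -> G x (f x)}.
  apply: (@boolp.choice _ _ (fun x y => X x -> G x y)) => x; have [Xx|nXx] := pselect (X x).
    by have [y Gxy] := GX x Xx; exists y.
  by exists 0.
exists f; split.
  split=> [x Xx|x x' /set_mem Xx /set_mem Xx' E|y Yy] /=.
  - by have [] := GXY _ _ (fP x Xx).
  - by apply: (Ginj _ _ (f x)); [exact: fP|rewrite E; exact: fP].
  - have [x Gxy] := GY y Yy; have [Xx _] := GXY _ _ Gxy.
    by exists x => //; apply: Gfun Gxy; exact: fP.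
move: dG; congr definable; apply/seteqP; split=> z /=.
  move=> Gz; have [Xz _] := GXY _ _ Gz; exists (lsubmx z) => //.
  by rewrite (Gfun _ _ _ (fP _ Xz) Gz) hsubmxK.
by move=> [x Xx <-]; rewrite row_mxKl row_mxKr; exact: fP.
Qed.

Lemma graph_definable_colsub n m k (r : 'I_n -> 'I_k) (r' : 'I_m -> 'I_k)
    (G : 'rV[K]_n -> 'rV[K]_m -> Prop) :
  graph_definable G -> definable [set z : 'rV_k | G (colsub r z) (colsub r' z)].
Proof.
pose s (i : 'I_(n + m)) :=
  match fintype.split i with inl j => r j | inr j => r' j end.
move=> /(definable_colsub s); congr definable; apply/seteqP.
have E (z : 'rV[K]_k) : (lsubmx (colsub s z) = colsub r z) *
                        (rsubmx (colsub s z) = colsub r' z).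
  split; apply/rowP => i; rewrite !mxE /s.
    by rewrite (unsplitK (inl i : 'I_n + 'I_m)).
  by rewrite (unsplitK (inr i : 'I_n + 'I_m)).
by split=> z /=; rewrite !E.
Qed.

Lemma definably_bijective_colsub n m (r : 'I_m -> 'I_n) (r' : 'I_n -> 'I_m)
    (X : set 'rV[K]_n) (Y : set 'rV[K]_m) :
    cancel r r' -> cancel r' r ->
    definable X -> (forall x, X x <-> Y (colsub r x)) ->
  definably_bijective X Y.
Proof.
move=> rK r'K dX XY; apply/definably_bijectiveP.
exists (fun x y => X x /\ y = colsub r x); split.
  have := definableI (definable_colsub (@lshift n m) dX)
    (definable_eqcols (@rshift n m) (@lshift n m \o r)).
  congr definable; apply/seteqP; split=> z /=;
    rewrite lsubmxEsub rsubmxEsub; rewrite (_ : colsub r _ = colsub (@lshift n m \o r) z) //;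
    by apply/rowP => i; rewrite !mxE.
have colK x : colsub r' (colsub r x) = x :> 'rV[K]_n.
  by apply/rowP => i; rewrite !mxE r'K.
have colK' x : colsub r (colsub r' x) = x :> 'rV[K]_m.
  by apply/rowP => i; rewrite !mxE rK.
split.
- by move=> x y [Xx ->]; split=> //; apply/XY.
- by move=> x Xx; exists (colsub r x).
- by move=> y Yy; exists (colsub r' y); split; rewrite ?colK' //; apply/XY; rewrite colK'.
- by move=> x y y' [_ ->] [].
- by move=> x x' y [_ ->] [_ /(congr1 (colsub r'))]; rewrite !colK.
Qed.

Lemma definably_bijective_refl n (X : set 'rV[K]_n) :
  definable X -> definably_bijective X X.
Proof.
move=> dX; apply: (@definably_bijective_colsub _ _ id id) => // x.
by rewrite (_ : colsub id x = x) //; apply/rowP => i; rewrite mxE.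
Qed.

Lemma definably_bijective_sym n m (X : set 'rV[K]_n) (Y : set 'rV[K]_m) :
  definably_bijective X Y -> definably_bijective Y X.
Proof.
move=> /definably_bijectiveP[G [dG [GXY GX GY Gf Gi]]].
apply/definably_bijectiveP; exists (fun y x => G x y); split.
  have := graph_definable_colsub (@rshift m n) (@lshift m n) dG; congr definable.
  by apply/seteqP; split=> z /=; rewrite lsubmxEsub rsubmxEsub.
split; [|by []..|by move=> y x x'; exact: Gi|by move=> y y' x; exact: Gf].
by move=> y x /GXY[].
Qed.

Lemma definably_bijective_trans n m k (X : set 'rV[K]_n) (Y : set 'rV[K]_m)
    (Z : set 'rV[K]_k) :
  definably_bijective X Y -> definably_bijective Y Z -> definably_bijective X Z.
Proof.
move=> /definably_bijectiveP[G [dG [GXY GX GY Gf Gi]]].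
move=> /definably_bijectiveP[H [dH [HYZ HY HZ Hf Hi]]].
apply/definably_bijectiveP; exists (fun x z => exists y, G x y /\ H y z); split.
  have dG' := graph_definable_colsub (@rshift m (n + k) \o @lshift n k) (@lshift m (n + k)) dG.
  have dH' := graph_definable_colsub (@lshift m (n + k)) (@rshift m (n + k) \o @rshift n k) dH.
  have := definable_exists (definableI dG' dH'); congr definable.
  have E (y : 'rV[K]_m) (x : 'rV[K]_(n + k)) :
      (colsub (@lshift m (n + k)) (row_mx y x) = y) *
      (colsub (@rshift m (n + k) \o @lshift n k) (row_mx y x) = lsubmx x) *
      (colsub (@rshift m (n + k) \o @rshift n k) (row_mx y x) = rsubmx x).
    by do 2?split; apply/rowP => i; rewrite mxE /= ?row_mxEl ?row_mxEr ?mxE.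
  by apply/seteqP; split=> x /= -[y]; rewrite ?E => GH; exists y; rewrite ?E.
split.
- by move=> x z [y [/GXY[? _] /HYZ[_ ?]]].
- move=> x /GX[y Gxy]; have [_ /HY[z Hyz]] := GXY _ _ Gxy.
  by exists z, y.
- move=> z /HZ[y Hyz]; have [/GY[x Gxy] _] := HYZ _ _ Hyz.
  by exists x, y.
- move=> x z z' [y [Gxy Hyz]] [y' [Gxy' Hyz']].
  by rewrite (Gf _ _ _ Gxy Gxy') in Hyz; exact: Hf Hyz Hyz'.
- move=> x x' z [y [Gxy Hyz]] [y' [Gxy' Hyz']].
  by rewrite (Hi _ _ _ Hyz Hyz') in Gxy; exact: Gi Gxy Gxy'.
Qed.

Lemma definably_bijective_cartesian n m n' m' (X : set 'rV[K]_n)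
    (Y : set 'rV[K]_m) (X' : set 'rV[K]_n') (Y' : set 'rV[K]_m') :
    definably_bijective X X' -> definably_bijective Y Y' ->
  definably_bijective (cartesian X Y) (cartesian X' Y').
Proof.
move=> /definably_bijectiveP[G [dG [GXY GX GY Gf Gi]]].
move=> /definably_bijectiveP[H [dH [HXY HX HY Hf Hi]]].
apply/definably_bijectiveP; rewrite !cartesianE.
exists (fun x y => G (lsubmx x) (lsubmx y) /\ H (rsubmx x) (rsubmx y)); split.
  pose l := @lshift (n + m) (n' + m'); pose r := @rshift (n + m) (n' + m').
  have dG' := graph_definable_colsub (l \o @lshift n m) (r \o @lshift n' m') dG.
  have dH' := graph_definable_colsub (l \o @rshift n m) (r \o @rshift n' m') dH.
  have := definableI dG' dH'; congr definable.
  have E (z : 'rV[K]_((n + m) + (n' + m'))) :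
      (colsub (l \o @lshift n m) z = lsubmx (lsubmx z)) *
      (colsub (l \o @rshift n m) z = rsubmx (lsubmx z)) *
      (colsub (r \o @lshift n' m') z = lsubmx (rsubmx z)) *
      (colsub (r \o @rshift n' m') z = rsubmx (rsubmx z)).
    by do 3?split; apply/rowP => i; rewrite !mxE.
  by apply/seteqP; split=> z /=; rewrite !E.
split.
- by move=> x y [/GXY[? ?] /HXY[? ?]].
- move=> x [/GX[y1 Gy] /HX[y2 Hy]].
  by exists (row_mx y1 y2); rewrite row_mxKl row_mxKr.
- move=> y [/GY[x1 Gx] /HY[x2 Hx]].
  by exists (row_mx x1 x2); rewrite row_mxKl row_mxKr.
- move=> x y y' [Gy Hy] [Gy' Hy']; rewrite -[y]hsubmxK -[y']hsubmxK.
  by rewrite (Gf _ _ _ Gy Gy') (Hf _ _ _ Hy Hy').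
- move=> x x' y [Gx Hx] [Gx' Hx']; rewrite -[x]hsubmxK -[x']hsubmxK.
  by rewrite (Gi _ _ _ Gx Gx') (Hi _ _ _ Hx Hx').
Qed.

Lemma definably_bijective_point n m (X : set 'rV[K]_n) (a : 'rV[K]_n) :
  definable X -> X = [set a] -> definably_bijective X [set 0 : 'rV[K]_m].
Proof.
move=> dX Xa; apply/definably_bijectiveP.
exists (fun x y => X x /\ [set 0] y); split.
  have := definableI (definable_colsub (@lshift n m) dX)
    (definable_colsub (@rshift n m) (definable_zero m)).
  congr definable.
  by apply/seteqP; split=> z /=; rewrite lsubmxEsub rsubmxEsub.
split=> //.
- by move=> x Xx; exists 0.
- by move=> y ->; exists a; rewrite Xa.
- by move=> x y y' [_ ->] [_ ->].
- by move=> x x' y; rewrite Xa => -[-> _] [-> _].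
Qed.

Record defset := Defset {
  dim : nat;
  dim_gt0 : (0 < dim)%N;
  carrier : set 'rV[K]_dim;
  carrierP : definable carrier
}.
Arguments carrier : clear implicits.

HB.instance Definition _ := gen_eqMixin defset.
HB.instance Definition _ := gen_choiceMixin defset.

Implicit Types A B C : defset.

Definition defset_iso A B : bool :=
  `[< definably_bijective (carrier A) (carrier B) >].

Fact defset_iso_equiv : equiv_class_of defset_iso.
Proof.
split=> [A|A B|B A C].
- by apply/asboolP/definably_bijective_refl; exact: carrierP.
- by apply/asboolP/asboolP; exact: definably_bijective_sym.
- by move=> /asboolP AB /asboolP BC; apply/asboolP; exact: definably_bijective_trans BC.
Qed.

Canonical defset_iso_equivRel := EquivRelPack defset_iso_equiv.
Canonical defset_iso_encModRel := defaultEncModRel defset_iso.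

Definition defclass := {eq_quot defset_iso}.
HB.instance Definition _ : EqQuotient defset defset_iso defclass :=
  EqQuotient.on defclass.
HB.instance Definition _ := Choice.on defclass.

Lemma defclassP A B :
  definably_bijective (carrier A) (carrier B) <-> \pi_defclass A = \pi_defclass B.
Proof. by split=> [AB|/eqmodP/asboolP//]; apply/eqmodP/asboolP. Qed.

Fact defset_mul_gt0 A B : (0 < dim A + dim B)%N.
Proof. by rewrite addn_gt0 dim_gt0. Qed.

Definition defset_mul A B : defset :=
  Defset (defset_mul_gt0 A B) (definable_cartesian (carrierP A) (carrierP B)).

Definition defset_point : defset := @Defset 1 isT _ (definable_zero 1).

Definition defclass_one : defclass := \pi defset_point.
Definition defclass_mul := lift_op2 defclass defset_mul.

Lemma pi_defset_mul :
  {morph \pi_defclass : A B / defset_mul A B >-> defclass_mul A B}.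
Proof.
move=> A B; unlock defclass_mul; apply/defclassP.
by apply: definably_bijective_cartesian; apply/defclassP; rewrite reprK.
Qed.

Fact defclass_mulC : commutative defclass_mul.
Proof.
move=> x y; rewrite -[x]reprK -[y]reprK -!pi_defset_mul; apply/defclassP.
move: (repr x) (repr y) => A B /=.
pose sw n m (i : 'I_(n + m)) : 'I_(m + n) :=
  match fintype.split i with inl j => rshift m j | inr j => lshift n j end.
have swK n m : cancel (@sw n m) (@sw m n).
  move=> i; rewrite /sw; case: (fintype.splitP i) => j ij.
    by rewrite (unsplitK (inr j : 'I_m + 'I_n)); exact/val_inj.
  by rewrite (unsplitK (inl j : 'I_m + 'I_n)); exact/val_inj.
apply: (@definably_bijective_colsub _ _ (@sw _ _) (@sw _ _)) => //.
  exact/definable_cartesian/carrierP/carrierP.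
move=> z; rewrite !cartesianE /=.
rewrite (_ : lsubmx (colsub _ _) = rsubmx z); last first.
  by apply/rowP => i; rewrite !mxE /sw (unsplitK (inl i : 'I__ + 'I__)).
rewrite (_ : rsubmx (colsub _ _) = lsubmx z); last first.
  by apply/rowP => i; rewrite !mxE /sw (unsplitK (inr i : 'I__ + 'I__)).
by split=> -[].
Qed.

Fact defclass_mulA : associative defclass_mul.
Proof.
move=> x y z; rewrite -[x]reprK -[y]reprK -[z]reprK -!pi_defset_mul.
apply/defclassP; move: (repr x) (repr y) (repr z) => A B C /=.
have E := addnA (dim A) (dim B) (dim C).
apply: (@definably_bijective_colsub _ _ (cast_ord (esym E)) (cast_ord E)).
- exact: cast_ordKV.
- exact: cast_ordK.
- by do 2?apply: definable_cartesian; exact: carrierP.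
move=> w; rewrite !cartesianE /=.
rewrite (_ : lsubmx (lsubmx (colsub _ _)) = lsubmx w); last first.
  by apply/rowP => i; rewrite !mxE; congr (w _ _); exact/val_inj.
rewrite (_ : rsubmx (lsubmx (colsub _ _)) = lsubmx (rsubmx w)); last first.
  by apply/rowP => i; rewrite !mxE; congr (w _ _); exact/val_inj.
rewrite (_ : rsubmx (colsub _ _) = rsubmx (rsubmx w)); last first.
  by apply/rowP => i; rewrite !mxE; congr (w _ _); apply/val_inj => /=; rewrite addnA.
by split=> [[? []]|[[]]].
Qed.

Fact defclass_mul1 : left_id defclass_one defclass_mul.
Proof.
move=> x; rewrite -[x]reprK -pi_defset_mul; apply/defclassP.
move: (repr x) => A /=; apply/definably_bijective_sym/definably_bijectiveP.
exists (fun x y => carrier A x /\ y = row_mx 0 x); split.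
  have := definableI (definable_colsub (@lshift (dim A) (1 + dim A)) (carrierP A))
    (definableI (definable_colsub (@rshift (dim A) (1 + dim A) \o @lshift 1 (dim A)) (definable_zero 1))
     (definable_eqcols (@rshift (dim A) (1 + dim A) \o @rshift 1 (dim A)) (@lshift (dim A) (1 + dim A)))).
  congr definable; apply/seteqP.
  have E (z : 'rV[K]_(dim A + (1 + dim A))) :
      (colsub (@rshift (dim A) (1 + dim A) \o @lshift 1 (dim A)) z = lsubmx (rsubmx z)) *
      (colsub (@rshift (dim A) (1 + dim A) \o @rshift 1 (dim A)) z = rsubmx (rsubmx z)).
    by split; apply/rowP => i; rewrite !mxE.
  split=> z /=; rewrite !E -!lsubmxEsub.
    by move=> [Az [z0 zE]]; split=> //; rewrite -[rsubmx z]hsubmxK z0 zE.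
  by move=> [Az ->]; rewrite row_mxKl row_mxKr.
rewrite cartesianE; split.
- by move=> a y [Aa ->] /=; rewrite row_mxKl row_mxKr.
- by move=> a Aa; exists (row_mx 0 a).
- by move=> y [y0 Ay]; exists (rsubmx y); split=> //; rewrite -y0 hsubmxK.
- by move=> a y y' [_ ->] [_ ->].
- by move=> a a' y [_ ->] [_ /eq_row_mx[]].
Qed.

Fact defclass_mulr1 : right_id defclass_one defclass_mul.
Proof. by move=> x; rewrite defclass_mulC defclass_mul1. Qed.

Lemma defclass_point A (a : 'rV_(dim A)) :
  carrier A = [set a] -> \pi A = defclass_one.
Proof. by move=> Aa; apply/defclassP/definably_bijective_point/Aa/carrierP. Qed.

Fact defclass_unit x y :
  defclass_mul x y = defclass_one -> x = defclass_one /\ y = defclass_one.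
Proof.
rewrite -[x]reprK -[y]reprK -pi_defset_mul => /defclassP.
move: (repr x) (repr y) => A B /=; rewrite cartesianE.
move=> /definably_bijectiveP[G [_ [GXY GX GY Gf Gi]]].
have [z Gz] := GY 0 erefl; have [[Az Bz] _] := GXY _ _ Gz.
have zP u : carrier A (lsubmx u) -> carrier B (rsubmx u) -> u = z.
  move=> Au Bu; have [v Gv] := GX u (conj Au Bu); have [_ v0] := GXY _ _ Gv.
  by apply: (Gi _ _ v) => //; rewrite v0.
split; [apply: (@defclass_point _ (lsubmx z))|apply: (@defclass_point _ (rsubmx z))];
  apply/seteqP; split=> u /= => [Au|->//].
  by rewrite -(zP (row_mx u (rsubmx z))) ?row_mxKl ?row_mxKr.
by rewrite -(zP (row_mx (lsubmx z) u)) ?row_mxKl ?row_mxKr.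
Qed.

HB.instance Definition _ := Choice_isMonomialDef.Build defclass
  defclass_mulA defclass_mul1 defclass_mulr1 defclass_unit.
HB.instance Definition _ := MonomialDef_isConomialDef.Build defclass defclass_mulC.

(* {malg int[defclass]} is the free abelian group on the classes of definable
   sets modulo definable bijection; its product extends bilinearly the
   Cartesian product of classes. *)
Definition gclass n (n_gt0 : (0 < n)%N) (X : set 'rV[K]_n) (dX : definable X) :
  {malg int[defclass]} := << \pi_defclass (Defset n_gt0 dX) >>.

(* The relation [set0] = 0 does not follow from the union-intersection
   relations alone: without it, sending every class to 1 would define a ring
   morphism onto int. *)
Inductive scissor_relation : {malg int[defclass]} -> Prop :=
| scissor_set0 n (n_gt0 : (0 < n)%N) :
    scissor_relation (gclass n_gt0 (definable0 n))
| scissor_setUI n (n_gt0 : (0 < n)%N) (X Y : set 'rV[K]_n)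
    (dX : definable X) (dY : definable Y) :
    scissor_relation (gclass n_gt0 dX + gclass n_gt0 dY
      - (gclass n_gt0 (definableU dX dY) + gclass n_gt0 (definableI dX dY))).

(* The subgroup generated by the relations. *)
Inductive scissor_span : {malg int[defclass]} -> Prop :=
| scissor_span_gen z of scissor_relation z : scissor_span z
| scissor_span0 : scissor_span 0
| scissor_spanB z w of scissor_span z & scissor_span w : scissor_span (z - w).

Definition scissor_group : {pred {malg int[defclass]}} :=
  fun z => `[< scissor_span z >].

Fact scissor_group_closed : zmod_closed scissor_group.
Proof.
split=> [|z w /asboolP sz /asboolP sw]; first exact/asboolP/scissor_span0.
exact/asboolP/scissor_spanB.
Qed.
HB.instance Definition _ :=
  GRing.isZmodClosed.Build _ scissor_group scissor_group_closed.

Lemma gclassM A n n_gt0 (X : set 'rV[K]_n) (dX : definable X) :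
  << \pi_defclass A >> * gclass n_gt0 dX =
  gclass (defset_mul_gt0 A (Defset n_gt0 dX)) (definable_cartesian (carrierP A) dX).
Proof.
rewrite malgM_def fgmulUU mul1r; congr << _ >>.
exact/esym/pi_defset_mul.
Qed.

Lemma eq_gclass n n_gt0 n_gt0' (X Y : set 'rV[K]_n) (dX : definable X)
  (dY : definable Y) : X = Y -> gclass n_gt0 dX = gclass n_gt0' dY.
Proof.
move=> XY; congr << _ >>; apply/defclassP => /=; rewrite -XY.
exact: definably_bijective_refl.
Qed.

Lemma scissor_setUI_eq n (n1 n2 n3 n4 : (0 < n)%N) (X Y U I : set 'rV[K]_n)
    (dX : definable X) (dY : definable Y) (dU : definable U)
    (dI : definable I) : U = X `|` Y -> I = X `&` Y ->
  scissor_relation (gclass n1 dX + gclass n2 dY - (gclass n3 dU + gclass n4 dI)).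
Proof.
move=> UE IE; subst U I.
rewrite (bool_irrelevance n2 n1) (bool_irrelevance n3 n1).
rewrite (bool_irrelevance n4 n1) (Prop_irrelevance dU (definableU dX dY)).
by rewrite (Prop_irrelevance dI (definableI dX dY)); exact: scissor_setUI.
Qed.

Lemma scissor_group_ideal z w : w \in scissor_group -> z * w \in scissor_group.
Proof.
move=> /asboolP sw; rewrite [z]monalgE mulr_suml; apply: rpred_sum => c _.
have -> : << z@_c *g c >> = << c >> *~ z@_c.
  by rewrite -(raddfMz (mkmalgU c)) intz.
rewrite mulrzAl; apply: rpredMz; rewrite -[c]reprK.
elim: sw => [u|/=|u v _ IHu _ IHv]; last 2 first.
- by rewrite mulr0 rpred0.
- by rewrite mulrBr rpredB.
case=> [n n0|n n0 X Y dX dY]; apply/asboolP/scissor_span_gen.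
  rewrite gclassM (@eq_gclass _ _ (defset_mul_gt0 _ _) _ set0 _ (definable0 _)).
    exact: scissor_set0.
  by apply/seteqP; split=> // z' [? _ []].
rewrite mulrBr !mulrDr !gclassM.
by apply: scissor_setUI_eq; rewrite !cartesianE; apply/seteqP; split=> x /=;
  tauto.
Qed.

(* A ring that may be trivial, hence a comPzRingType. *)
Definition K0 := Quotient.quot scissor_group.
HB.instance Definition _ := GRing.Zmodule.on K0.
HB.instance Definition _ := EqQuotient.on K0.

Definition K0_one : K0 := \pi 1.
Definition K0_mul := lift_op2 K0 (fun z w : {malg int[defclass]} => z * w).

Lemma pi_K0E z w : \pi_K0 z = \pi_K0 w <-> z - w \in scissor_group.
Proof. by split=> [/eqmodP|zw]; [|apply/eqmodP]. Qed.

Lemma pi_K0M : {morph \pi_K0 : z w / z * w >-> K0_mul z w}.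
Proof.
move=> z w; unlock K0_mul; apply/pi_K0E.
rewrite (_ : _ - _ = w * (z - repr (\pi_K0 z))
  + repr (\pi_K0 z) * (w - repr (\pi_K0 w))); last first.
  by rewrite !mulrBr [w * z]mulrC [w * _]mulrC addrA subrK.
by rewrite rpredD //; apply: scissor_group_ideal; apply/pi_K0E; rewrite reprK.
Qed.

Lemma pi_K0D : {morph \pi_K0 : z w / z + w}.
Proof. by move=> z w; rewrite !piE. Qed.

Fact K0_mulA : associative K0_mul.
Proof.
by move=> x y z; rewrite -[x]reprK -[y]reprK -[z]reprK -!pi_K0M mulrA.
Qed.

Fact K0_mulC : commutative K0_mul.
Proof. by move=> x y; rewrite -[x]reprK -[y]reprK -!pi_K0M mulrC. Qed.

Fact K0_mul1 : left_id K0_one K0_mul.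
Proof. by move=> x; rewrite -[x]reprK -!pi_K0M mul1r. Qed.

Fact K0_mulD : left_distributive K0_mul +%R.
Proof.
move=> x y z; rewrite -[x]reprK -[y]reprK -[z]reprK.
by rewrite -pi_K0D -!pi_K0M mulrDl pi_K0D.
Qed.

HB.instance Definition _ :=
  GRing.Zmodule_isComPzRing.Build K0 K0_mulA K0_mulC K0_mul1 K0_mulD.

End Definability.

(* Main.v *)
(* Let O be the valuation ring, q = #|F| and s = t^(q-1). The set P of the
   elements w^(q-1) (1 + t z) of O with w <> 0 is the disjoint union of
   U = 1 + t O and s P, so multiplication by s frees copies of U ~ O inside P.
   Since O^2 minus the origin splits into {y <> 0, x in y O} and
   {x <> 0, y in t x O}, both in definable bijection with O x (O minus 0),
   shifting P x (O minus 0) twice makes room for these two pieces, and P x O is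
   thereby in definable bijection with itself minus one point. As
   (x, y) |-> x^q + t y^q embeds O^2 in O, this gives a definable bijection from
   O onto O minus a point, and then the class of a point, the unit of the
   Grothendieck ring, vanishes. The ring O itself is definable:
   x is in O iff t x^q = y^q - y for some y. *)
Require Import Defs.
From mathcomp Require Import all_boot all_order all_algebra all_field.
From mathcomp Require Import boolp classical_sets functions fsbigop.
From mathcomp Require Import generic_quotient monalg.
From mathcomp Require Import zify ring.
Local Open Scope classical_set_scope.
Local Open Scope ring_scope.

Set Implicit Arguments.
Unset Strict Implicit.
Unset Printing Implicit Defensive.
Import Order.TTheory GRing.Theory Num.Theory.

(** * Definability of predicates on environments of variables *)

Section EnvironmentDefinability.
Variables (K : comNzRingType) (t : K).
Implicit Types (e : nat -> K) (A B : (nat -> K) -> Prop) (f g : (nat -> K) -> K).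

(** Padding by 0 beyond [n] gives all arities the same type of environments, so that going under a
    quantifier is a shift of indices. *)
Definition env n (x : 'rV[K]_n) (i : nat) : K :=
  if insub i is Some j then x 0 j else 0.

Lemma envE n (x : 'rV[K]_n) (i : 'I_n) : env x i = x 0 i.
Proof. by rewrite /env valK. Qed.

Lemma env_row_mx n (y : K) (x : 'rV[K]_n) :
  (env (row_mx (const_mx y : 'rV_1) x) 0 = y) *
  ((fun i => env (row_mx (const_mx y : 'rV_1) x) i.+1) = env x).
Proof.
split.
  have := @envE _ (row_mx (const_mx y : 'rV_1) x) (lshift n (0 : 'I_1)).
  by rewrite row_mxEl mxE.
apply/funext => i; have [lt_in|le_ni] := ltnP i n.
  rewrite (@envE _ x (Ordinal lt_in)) -(@row_mxEr _ _ 1 n (const_mx y : 'rV_1)).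
  by rewrite -envE.
by rewrite /env !insubF // ltnNge ?ltnS ?le_ni.
Qed.

Definition term_def n f := exists s : Lt_term n, forall x, Lt_eval t x s = f (env x).

Definition env_def n A :=
  exists phi : Lt_formula n, forall x, Lt_sat t phi x <-> A (env x).

Lemma term_var n i : (i < n)%N -> term_def n (fun e => e i).
Proof.
by move=> lt_in; exists (TVar (Ordinal lt_in)) => x; rewrite /= -envE.
Qed.

Lemma term_0 n : term_def n (fun=> 0). Proof. by exists TZero. Qed.

Lemma term_1 n : term_def n (fun=> 1). Proof. by exists TOne. Qed.

Lemma term_t n : term_def n (fun=> t). Proof. by exists Tt. Qed.

Lemma term_opp n f : term_def n f -> term_def n (fun e => - f e).
Proof. by move=> [s sE]; exists (TOpp s) => x /=; rewrite sE. Qed.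

Lemma term_add n f g :
  term_def n f -> term_def n g -> term_def n (fun e => f e + g e).
Proof. by move=> [s sE] [u uE]; exists (TAdd s u) => x /=; rewrite sE uE. Qed.

Lemma term_mul n f g :
  term_def n f -> term_def n g -> term_def n (fun e => f e * g e).
Proof. by move=> [s sE] [u uE]; exists (TMul s u) => x /=; rewrite sE uE. Qed.

Lemma term_exp n f k : term_def n f -> term_def n (fun e => f e ^+ k).
Proof.
move=> df; elim: k => [|k IH].
  by rewrite (_ : (fun _ => _) = fun=> 1); [exact: term_1|apply/funext].
rewrite (_ : (fun _ => _) = fun e => f e * f e ^+ k); first exact: term_mul.
by apply/funext => e; rewrite exprS.
Qed.

(** Weakening under a quantifier: index 0 now belongs to the bound variable. *)
Lemma term_shift n f : term_def n f -> term_def n.+1 (fun e => f (fun i => e i.+1)).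
Proof.
move=> [s sE]; exists (Lt_term_ren (@rshift 1 n) s) => x.
rewrite Lt_eval_ren sE; congr f; rewrite -[in RHS](@hsubmxK _ _ 1 n x).
have -> : @lsubmx _ 1 1 n x = const_mx (x 0 0).
  by apply/rowP => i; rewrite !mxE ord1; congr (x _ _); exact: val_inj.
by rewrite env_row_mx; congr env; apply/rowP => i; rewrite !mxE.
Qed.

Lemma def_iff n A B : (forall e, A e <-> B e) -> env_def n A -> env_def n B.
Proof. by move=> AB [phi phiE]; exists phi => x; rewrite phiE. Qed.

Lemma def_eq n f g : term_def n f -> term_def n g -> env_def n (fun e => f e = g e).
Proof. by move=> [s sE] [u uE]; exists (FEq s u) => x /=; rewrite sE uE. Qed.

Lemma def_not n A : env_def n A -> env_def n (fun e => ~ A e).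
Proof. by move=> [phi phiE]; exists (FNot phi) => x /=; rewrite phiE. Qed.

Lemma def_and n A B : env_def n A -> env_def n B -> env_def n (fun e => A e /\ B e).
Proof.
by move=> [phi phiE] [psi psiE]; exists (FAnd phi psi) => x /=; rewrite phiE psiE.
Qed.

Lemma def_or n A B : env_def n A -> env_def n B -> env_def n (fun e => A e \/ B e).
Proof.
move=> dA dB; apply: (def_iff _ (def_not (def_and (def_not dA) (def_not dB)))) => e.
by rewrite not_andE !notK.
Qed.

Lemma def_exists n (A : K -> (nat -> K) -> Prop) :
  env_def n.+1 (fun e => A (e 0) (fun i => e i.+1)) ->
  env_def n (fun e => exists y, A y e).
Proof.
move=> [phi phiE]; exists (FExists phi) => x /=.
by split=> -[y Ay]; exists y; move: Ay; rewrite phiE !env_row_mx.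
Qed.

Lemma env_def_definable n A (X : set 'rV[K]_n) :
  env_def n A -> (forall x, X x <-> A (env x)) -> definable t X.
Proof.
move=> [phi phiE] XA; exists phi.
by apply/seteqP; split=> x /=; rewrite phiE XA.
Qed.

End EnvironmentDefinability.

(** * Coefficients of Laurent series and their valuation ring *)

Section LaurentField.
Variable F : fieldType.
Local Notation L := (laurent F).
Local Notation t := (laurent_t F).
Local Notation O := (valring F).
Implicit Types (f g x y : L) (n m : int).

Lemma lcoefD f g n : lcoef (f + g) n = lcoef f n + lcoef g n.
Proof. by []. Qed.

Lemma lcoefN f n : lcoef (- f) n = - lcoef f n.
Proof. by []. Qed.

Lemma lcoef0 n : lcoef (0 : L) n = 0.
Proof. by []. Qed.

Lemma lcoef1 n : lcoef (1 : L) n = (n == 0)%:R.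
Proof. by []. Qed.

Definition lterm (c : F) (d : int) : L.
Proof.
exists (fun n => if n == d then c else 0).
by exists d => n; rewrite lt_neqAle => /andP[/negPf->].
Defined.

Lemma lcoef_term c d n : lcoef (lterm c d) n = if n == d then c else 0.
Proof. by []. Qed.

Lemma lcoef_termM c d f n : lcoef (lterm c d * f) n = c * lcoef f (n - d).
Proof.
rewrite -[LHS]/(lmul_coef (lterm c d) f n) /lmul_coef (fsbigE [:: d]) //=.
  by rewrite big_cons big_nil in_setT eqxx addr0.
by move=> i _; rewrite inE => /negPf->; rewrite mul0r.
Qed.

Lemma laurent_tE : t = lterm 1 1.
Proof. by apply: laurentP => n /=; case: eqP. Qed.

Lemma lcoef_tM f n : lcoef (t * f) n = lcoef f (n - 1).
Proof. by rewrite laurent_tE lcoef_termM mul1r. Qed.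

Lemma lterm_exp c d k : lterm c d ^+ k = lterm (c ^+ k) (d *+ k).
Proof.
elim: k => [|k IH]; first by apply: laurentP => n; rewrite expr0 mulr0n lcoef1 /=; case: eqP.
rewrite exprS IH; apply: laurentP => n; rewrite lcoef_termM /= subr_eq addrC -mulrS.
by case: eqP; rewrite ?mulr0 -?exprS.
Qed.

Lemma t_neq0 : t != 0.
Proof.
by apply/eqP => /(congr1 (fun f : L => lcoef f 1)); rewrite lcoef0 /= => /eqP; rewrite oner_eq0.
Qed.

Definition vanishes_below m f := forall n, n < m -> lcoef f n = 0.

Lemma vanishes_belowM m k f g : vanishes_below m f -> vanishes_below k g ->
  vanishes_below (m + k) (f * g).
Proof. by move=> fm gk n; exact: lmul_coef_below. Qed.

Lemma vanishes_belowX m f k : vanishes_below m f -> vanishes_below (m *+ k) (f ^+ k).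
Proof.
move=> fm; elim: k => [|k IH]; last by rewrite exprS mulrS; exact: vanishes_belowM.
by move=> n; rewrite mulr0n expr0 lcoef1 => /lt_eqF->.
Qed.

Lemma lcoefM_lead m k f g : vanishes_below m f -> vanishes_below k g ->
  lcoef (f * g) (m + k) = lcoef f m * lcoef g k.
Proof.
move=> fm gk; have := lmul_coefE 0 fm gk.
by rewrite big_ord1 /= !addr0.
Qed.

Lemma laurent_lead f : f != 0 -> exists2 m, vanishes_below m f & lcoef f m != 0.
Proof.
move=> f0; have [m fm] := lcoef_bounded f.
have exP : exists k : nat, lcoef f (m + k%:Z) != 0.
  apply: contrapT => /forallNP fk; move/eqP: f0; apply.
  apply: (@laurent_ext _ m) => // d.
  by have /negP := fk d; rewrite negbK => /eqP ->.
case: (ex_minnP exP) => k fk mink; exists (m + k%:Z) => // n nv.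
have [/fm//|mn] := ltP n m.
have ne : n = m + `|n - m|%N%:Z by lia.
apply/eqP/negPn/negP => fn; have := mink `|n - m|%N.
by rewrite -ne => /(_ fn); lia.
Qed.

Lemma valring1 : O 1.
Proof. by move=> n; rewrite lcoef1 => /lt_eqF->. Qed.

Lemma valringD x y : O x -> O y -> O (x + y).
Proof. by move=> Ox Oy n n0; rewrite lcoefD Ox ?Oy ?addr0. Qed.

Lemma valringN x : O x -> O (- x).
Proof. by move=> Ox n n0; rewrite lcoefN Ox ?oppr0. Qed.

Lemma valringM x y : O x -> O y -> O (x * y).
Proof. by move=> Ox Oy; have := @vanishes_belowM 0 0 x y Ox Oy; rewrite addr0. Qed.

Lemma valring_t : O t.
Proof. by move=> n n0; rewrite laurent_tE /= ifF //; lia. Qed.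

Lemma valringX x k : O x -> O (x ^+ k).
Proof.
by move=> Ox; elim: k => [|k IH]; [exact: valring1|rewrite exprS; exact: valringM].
Qed.

Lemma lcoef0M x y : O x -> O y -> lcoef (x * y) 0 = lcoef x 0 * lcoef y 0.
Proof. by move=> Ox Oy; have := @lcoefM_lead 0 0 x y Ox Oy; rewrite addr0. Qed.

Lemma lcoef0X x k : O x -> lcoef (x ^+ k) 0 = lcoef x 0 ^+ k.
Proof.
move=> Ox; elim: k => [|k IH]; first by rewrite !expr0 lcoef1 eqxx.
by rewrite !exprS lcoef0M ?IH //; exact: valringX.
Qed.

Lemma lcoef0_tM x : O x -> lcoef (t * x) 0 = 0.
Proof. by move=> Ox; rewrite lcoef_tM Ox. Qed.

Lemma valring_divt x : O x -> lcoef x 0 = 0 -> exists2 y, O y & x = t * y.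
Proof.
move=> Ox x0; exists (lterm 1 (-1) * x).
  move=> n n0; rewrite lcoef_termM mul1r opprK.
  by have [->//|n1] := eqVneq n (-1); rewrite Ox //; lia.
by apply: laurentP => n; rewrite lcoef_tM lcoef_termM mul1r opprK subrK.
Qed.

(** The valuation is an integer: if that of [x] is negative, it is at most -1, so [t * x] has
    valuation at most 0. The factor [t] makes the two alternatives exclusive. *)
Lemma valring_total x : x != 0 -> O x \/ O (t * x)^-1.
Proof.
move=> x0; have [m xm xm0] := laurent_lead x0.
have [m0|m0] := leP 0 m; [left=> n n0; apply: xm; exact: lt_le_trans m0|right].
have tx0 : t * x != 0 by rewrite mulf_neq0 ?t_neq0.
have [k yk yk0] := laurent_lead (invr_neq0 tx0).
have txm : vanishes_below (m + 1) (t * x).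
  by move=> n nm; rewrite lcoef_tM xm // ltrBlDr.
(* The lowest coefficient of [(t * x) * (t * x)^-1 = 1] is nonzero, so it sits in degree 0; hence
   [k = - (m + 1)], which is nonnegative. *)
have := lcoefM_lead txm yk; rewrite mulfV // lcoef_tM addrK lcoef1.
case: eqP => [E _|_ /esym/eqP]; last by rewrite mulf_eq0 (negPf xm0) (negPf yk0).
by move=> n n0; apply: yk; lia.
Qed.

Lemma tV_notin_valring : ~ O t^-1.
Proof.
move=> Ot; have := lcoef0_tM Ot; rewrite mulfV ?t_neq0 // lcoef1 => /eqP.
by rewrite oner_eq0.
Qed.

End LaurentField.

(** * The Frobenius power and the embedding of pairs *)

Section FiniteResidueField.
Variable F : finFieldType.
Local Notation L := (laurent F).
Local Notation t := (laurent_t F).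
Local Notation O := (valring F).
Local Notation q := #|F|.
Implicit Types (f g x y z : L) (n m : int).

Let q_gt1 : (1 < q)%N := finNzRing_gt1 F.

(** [q] is a power of the characteristic, which [F] shares with its Laurent series. *)
Lemma laurent_exprDq f g : (f + g) ^+ q = f ^+ q + g ^+ q.
Proof.
have [p p_pr pF] := finPcharP F.
have pL : p \in [pchar L].
  rewrite inE p_pr /=; apply/eqP/laurentP => n.
  have E (k : nat) : lcoef (k%:R : L) n = (n == 0)%:R *+ k.
    elim: k => [|k IH]; first by rewrite !mulr0n lcoef0.
    by rewrite -addn1 mulrnDr lcoefD IH lcoef1 mulrnDr mulr1n.
  by rewrite E lcoef0 mulrn_pchar.
apply: exprDn_pchar; rewrite (eq_pnat _ (pcharf_eq pL)).
by rewrite [#|F|](card_pprimeChar pF) pnatX pnat_id.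
Qed.

Lemma lcoef_expq f n :
  lcoef (f ^+ q) n = if (q %| n)%Z then lcoef f (n %/ q)%Z else 0.
Proof.
(* Additivity of the [q]-th power handles only finite sums, so leading terms are peeled off one at a
   time; after [N] of them the rest contributes nothing in degree [n]. *)
suff H (N : nat) : forall m f, vanishes_below m f -> forall n, n < q%:Z * (m + N%:Z) ->
    lcoef (f ^+ q) n = if (q %| n)%Z then lcoef f (n %/ q)%Z else 0.
  have [m fm] := lcoef_bounded f; apply: (H (`|n| + `|m|).+1%N m) => //.
  apply: (@lt_le_trans _ _ (m + (`|n| + `|m|).+1%N%:Z)); first lia.
  by apply: ler_peMl; lia.
elim: N => [|N IH] {n f} m f fm n nm.
  rewrite (vanishes_belowX fm); last by rewrite -mulr_natl; lia.
  by case: ifP => // /dvdzP[k nk]; rewrite fm // nk mulzK; nia.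
pose h := lterm (lcoef f m) m; pose g := f - h.
have gm : vanishes_below (m + 1) g.
  move=> k km; rewrite lcoefD lcoefN lcoef_term; case: eqP => [->|kNm]; first by rewrite subrr.
  by rewrite fm ?subr0 //; lia.
have -> : f = h + g by rewrite addrC subrK.
rewrite laurent_exprDq !lcoefD (IH _ _ gm); last by lia.
rewrite lterm_exp !lcoef_term expf_card.
have [/dvdzP[k ->]|nq] := boolP (q%:Z %| n)%Z.
  rewrite mulzK; last by lia.
  congr (_ + _); rewrite -mulr_natl natz.
  by have [->|km] := eqVneq k m; rewrite [_ * q%:Z]mulrC ?eqxx // ifF //; nia.
rewrite addr0; case: eqP => // E; move: nq; rewrite E -mulr_natl.
by rewrite natz dvdz_mulr.
Qed.

Lemma lcoef_expqM f n : lcoef (f ^+ q) (q%:Z * n) = lcoef f n.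
Proof. by rewrite lcoef_expq dvdz_mulr // mulKz //; lia. Qed.

Lemma lcoef_expqMS f n : lcoef (f ^+ q) (q%:Z * n + 1) = 0.
Proof. by rewrite lcoef_expq rpredDl ?dvdz_mulr // dvdzE dvdn1 gtn_eqF. Qed.

Lemma lcoef_expqMB f n : lcoef (f ^+ q) (q%:Z * n - 1) = 0.
Proof. by rewrite lcoef_expq rpredDl ?dvdz_mulr // dvdzE dvdn1 gtn_eqF. Qed.

Definition pack x y : L := x ^+ q + t * y ^+ q.

(** Since [q > 1], the coefficients in degrees 0 modulo [q] give back [x], and those in degrees 1
    modulo [q] give back [y]. *)
Lemma pack_inj x y x' y' : pack x y = pack x' y' -> x = x' /\ y = y'.
Proof.
move=> E; split; apply: laurentP => n.
  have := congr1 (fun f : L => lcoef f (q%:Z * n)) E.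
  by rewrite !lcoefD !lcoef_tM !lcoef_expqMB !addr0 !lcoef_expqM.
have := congr1 (fun f : L => lcoef f (q%:Z * n + 1)) E.
by rewrite !lcoefD !lcoef_tM !lcoef_expqMS !add0r addrK !lcoef_expqM.
Qed.

Lemma valring_pack x y : O x -> O y -> O (pack x y).
Proof.
move=> Ox Oy; apply: valringD; first exact: valringX.
by apply: valringM; [exact: valring_t|exact: valringX].
Qed.

(** * Artin-Schreier equations and the definability of the valuation ring *)

Section ArtinSchreier.
Variable a : nat -> F.

(* The coefficients of a root y of y^q - y = \sum_n (a n) t^n, obtained from
   y_n = - a n + y_(n/q); the recursion on n/q is bounded by the fuel. *)
Fixpoint as_coef (fuel n : nat) : F :=
  if fuel is k.+1 then
    if n == 0%N then 0
    else - a n + (if (q %| n)%N then as_coef k (n %/ q) else 0)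
  else 0.

Lemma as_coef_fuel (k n : nat) : (n <= k)%N -> as_coef k n = as_coef n n.
Proof.
elim/ltn_ind: n k => -[|n] IH [|k] //= nk; congr (_ + _); case: ifP => // _.
have lt_nq : (n.+1 %/ q < n.+1)%N by exact: ltn_Pdiv.
by rewrite IH ?[RHS]IH //; lia.
Qed.

Lemma as_coefE (n : nat) : (0 < n)%N ->
  as_coef n n = - a n + (if (q %| n)%N then as_coef (n %/ q) (n %/ q) else 0).
Proof.
case: n => // n _; rewrite [LHS]/=; congr (_ + _); case: ifP => // _.
have lt_nq : (n.+1 %/ q < n.+1)%N by exact: ltn_Pdiv.
by rewrite as_coef_fuel //; lia.
Qed.

End ArtinSchreier.

(** In degree 0 any constant [c] of [F] satisfies [c ^+ q - c = 0], whence the condition on [z]; the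
    root chosen has constant term 0. *)
Lemma artin_schreier_root z : O z -> lcoef z 0 = 0 -> exists y, y ^+ q - y = z.
Proof.
move=> Oz z0; pose a k := lcoef z k%:Z.
pose b (n : int) := if n is Posz k then as_coef a k k else 0.
have bB : exists m : int, forall n, n < m -> b n = 0 by exists 0; case.
pose y : L := Laurent bB; have yE (k : nat) : lcoef y k%:Z = as_coef a k k by [].
exists y; apply: laurentP => -[[|n]|n].
- by rewrite lcoefD lcoefN lcoef_expq dvdz0 div0z subrr z0.
- rewrite lcoefD lcoefN lcoef_expq divz_nat !yE [in X in _ - X]as_coefE //.
  by rewrite -[(q%:Z %| _)%Z]/(q %| n.+1)%N opprD opprK addrCA subrr addr0.
rewrite lcoefD lcoefN lcoef_expq Oz // [lcoef y (Negz n)]/= subr0.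
case: ifP => // /dvdzP[k E]; rewrite E mulzK; last by lia.
by case: k E => // k E; exfalso; nia.
Qed.

(** For integral [x] the right-hand side has constant term 0, so a root exists. Conversely, the
    exponents of [t * x ^+ q] are 1 modulo [q], and [y ^+ q] has no such term to cancel a pole. *)
Lemma valringE x : O x <-> exists y, y ^+ q - y = t * x ^+ q.
Proof.
split=> [Ox|[y E] n n0].
  have Oxq : O (x ^+ q) by exact: valringX.
  apply: artin_schreier_root; last exact: lcoef0_tM.
  by apply: valringM => //; exact: valring_t.
(* A nonzero coefficient x_n with n < 0 forces y_(q n + 1) <> 0, hence
   y_(q^k (q n + 1)) <> 0 for all k, so y would not be bounded below. *)
apply/eqP/negPn/negP => xn.
have ye k : lcoef (y ^+ q) k - lcoef y k = lcoef (x ^+ q) (k - 1).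
  by rewrite -lcoef_tM -E.
have y1 : lcoef y (q%:Z * n + 1) != 0.
  rewrite -oppr_eq0; have := ye (q%:Z * n + 1).
  by rewrite addrK lcoef_expqM lcoef_expqMS sub0r => ->.
have yk (k : nat) : lcoef y ((q ^ k)%N%:Z * (q%:Z * n + 1)) != 0.
  elim: k => [|k]; first by rewrite expn0 mul1r.
  have := ye (q%:Z * ((q ^ k)%N%:Z * (q%:Z * n + 1))).
  by rewrite lcoef_expqM lcoef_expqMB => /subr0_eq ->; rewrite mulrA -PoszM expnS.
(* The iterate [|m|] is enough: [q ^ |m| > |m|] and [q * n + 1 <= -1] put the exponent below [m]. *)
have [m ym] := lcoef_bounded y; have /negP := yk `|m|%N; apply; apply/eqP/ym.
have := ltn_expl `|m|%N q_gt1; move: (q ^ `|m|)%N => N mN.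
have : q%:Z * n + 1 <= -1 by nia.
by move: (q%:Z * n + 1) => k k1; nia.
Qed.


(** * A shift of pairs that misses exactly one point *)

Definition principal_unit x := exists z, O z /\ x = 1 + t * z.

Let s : L := t ^+ q.-1.

(* The subgroup generated by the (q-1)-th powers and the principal units,
   intersected with O; it is the union of the s^k (1 + t O). *)
Definition near_power x :=
  exists w, exists z, [/\ O w, w != 0, O z & x = w ^+ q.-1 * (1 + t * z)].

Lemma s_neq0 : s != 0.
Proof. by rewrite expf_neq0 ?t_neq0. Qed.

Lemma valring_s : O s.
Proof. exact/valringX/valring_t. Qed.

Lemma valring_1tM z : O z -> O (1 + t * z).
Proof.
move=> Oz; apply: valringD; first exact: valring1.
by apply: valringM => //; exact: valring_t.
Qed.

Lemma lcoef0_1tM z : O z -> lcoef (1 + t * z) 0 = 1.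
Proof. by move=> Oz; rewrite lcoefD lcoef1 lcoef0_tM // addr0. Qed.

Lemma lcoef0_sM x : O x -> lcoef (s * x) 0 = 0.
Proof.
move=> Ox; rewrite lcoef0M //; last exact: valring_s.
rewrite lcoef0X; last exact: valring_t.
have -> : lcoef t 0 = 0 by [].
by rewrite expr0n gtn_eqF ?mul0r // -subn1 subn_gt0.
Qed.

(** The constant terms are 1 and 0, the latter because [q - 1 > 0]. This separates most pieces of
    the shift below. *)
Lemma one_tM_neq_sM x z : O x -> O z -> 1 + t * z <> s * x.
Proof.
move=> Ox Oz /(congr1 (fun f : L => lcoef f 0)); rewrite lcoef0_1tM // lcoef0_sM //.
by move/eqP; rewrite oner_eq0.
Qed.

Lemma valring_near_power x : near_power x -> O x.
Proof.
move=> [w [z [Ow _ Oz ->]]]; apply: valringM; first exact: valringX.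
exact: valring_1tM.
Qed.

Lemma near_power1 z : O z -> near_power (1 + t * z).
Proof.
by move=> Oz; exists 1, z; split; rewrite ?oner_eq0 ?expr1n ?mul1r //; exact: valring1.
Qed.

Lemma near_power_sM x : near_power x -> near_power (s * x).
Proof.
move=> [w [z [Ow w0 Oz ->]]]; exists (t * w), z; split=> //.
- by apply: valringM => //; exact: valring_t.
- by rewrite mulf_neq0 ?t_neq0.
- by rewrite exprMn mulrA.
Qed.

(** If [t] divides [w], a factor [s] comes out of [w ^+ q.-1]. Otherwise the constant term of [w] is
    a nonzero element of [F], whose power [q - 1] is 1. *)
Lemma near_power_cases x : near_power x ->
  principal_unit x \/ exists2 u, near_power u & x = s * u.
Proof.
move=> Px; have Ox := valring_near_power Px; case: Px => w [z [Ow w0 Oz xE]].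
have [wc|wc] := eqVneq (lcoef w 0) 0.
  have [w' Ow' w'E] := valring_divt Ow wc; right.
  exists (w' ^+ q.-1 * (1 + t * z)); last by rewrite xE w'E exprMn mulrA.
  by exists w', z; split=> //; apply: contraNneq w0 => w'0; rewrite w'E w'0 mulr0.
left; have [||y Oy yE] := @valring_divt _ (x - 1).
- by apply: valringD => //; apply/valringN/valring1.
- rewrite lcoefD lcoefN xE lcoef0M ?lcoef0_1tM ?lcoef0X ?mulr1 ?lcoef1 ?eqxx //.
  + suff -> : lcoef w 0 ^+ q.-1 = 1 by rewrite subrr.
    by apply: (mulfI wc); rewrite -exprS prednK ?expf_card ?mulr1 // ltnW.
  + exact: valringX.
  + exact: valring_1tM.
- by exists y; split=> //; rewrite -yE addrC subrK.
Qed.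

(* The first two pieces cover the pairs (x', y') with x' in s near_power, and
   the last two cut the remaining pairs (1 + t a, b) <> (1, 0) according to
   whether a is a multiple of b or b is a multiple of t a. *)
Definition shift_graph x y x' y' :=
  (near_power x /\ y = 0 /\ x' = s * x /\ y' = 0) \/
  (O y /\ y <> 0 /\
    ((exists u, near_power u /\ x = s ^+ 2 * u /\ x' = s * u /\ y' = y) \/
     (exists z, O z /\ x = 1 + t * z /\ x' = 1 + t * (y * z) /\ y' = y) \/
     (exists z, O z /\ x = s * (1 + t * z) /\ x' = 1 + t * y /\ y' = t * (y * z)))).

(** The point (1, 0) is missed because the first piece has [x'] divisible by [s], the next two have
    [y' = y <> 0], and the last has [x' = 1 + t * y] with [y <> 0]. *)
Lemma shift_graph_sub x y x' y' : shift_graph x y x' y' ->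
  [/\ near_power x, O y, near_power x', O y' & ~ (x' = 1 /\ y' = 0)].
Proof.
case=> [[Px [-> [-> ->]]]|[Oy [y0 [|[|]]]]].
- have Px' := valring_near_power Px; split=> //; first exact: near_power_sM.
  by move=> [E _]; apply: (@one_tM_neq_sM x 0) => //; rewrite mulr0 addr0 E.
- move=> [u [Pu [-> [-> ->]]]]; split=> //; last by move=> [_ /y0].
    by rewrite expr2 -mulrA; do 2!apply: near_power_sM.
  exact: near_power_sM.
- move=> [z [Oz [-> [-> ->]]]]; split=> //; last by move=> [_ /y0].
    exact: near_power1.
  by apply/near_power1/valringM.
- move=> [z [Oz [-> [-> ->]]]]; split=> //.
  + exact/near_power_sM/near_power1.
  + exact: near_power1.
  + by apply: valringM; [exact: valring_t|exact: valringM].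
  case=> /eqP; rewrite -[X in _ == X]addr0 (inj_eq (addrI _)) mulf_eq0.
  by rewrite (negPf (t_neq0 _)) => /eqP.
Qed.

(** For [y <> 0], splitting [near_power] twice yields the classes of [1 + t z], [s (1 + t z)] and
    [s ^+ 2 * v], one for each remaining piece. *)
Lemma shift_graph_total x y : near_power x -> O y -> exists x' y', shift_graph x y x' y'.
Proof.
move=> Px Oy; have [y0|/eqP y0] := eqVneq y 0; first by exists (s * x), 0; left.
case: (near_power_cases Px) => [[z [Oz xE]]|[u Pu ->]].
  by exists (1 + t * (y * z)), y; right; do 2!split=> //; right; left; exists z.
case: (near_power_cases Pu) => [[z [Oz ->]]|[v Pv ->]].
  by exists (1 + t * y), (t * (y * z)); right; do 2!split=> //; right; right; exists z.
exists (s * v), y; right; do 2!split=> //; left; exists v.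
by rewrite mulrA -expr2.
Qed.

Lemma shift_graph_onto x' y' : near_power x' -> O y' -> ~ (x' = 1 /\ y' = 0) ->
  exists x y, shift_graph x y x' y'.
Proof.
move=> Px' Oy' n10; case: (near_power_cases Px') => [[a [Oa x'E]]|[u Pu ->]]; last first.
  have [->|/eqP y'0] := eqVneq y' 0; first by exists u, 0; left.
  by exists (s ^+ 2 * u), y'; right; do 2!split=> //; left; exists u.
have third z : O z -> y' <> 0 -> a = y' * z -> exists x y, shift_graph x y x' y'.
  move=> Oz y'0 aE; exists (1 + t * z), y'; right; do 2!split=> //; right; left.
  by exists z; rewrite -aE.
have fourth z : O z -> a <> 0 -> y' = t * (a * z) -> exists x y, shift_graph x y x' y'.
  by move=> Oz a0 y'E; exists (s * (1 + t * z)), a; right; do 2!split=> //; right; right; exists z.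
(* Here [a <> 0] is precisely the exclusion of (1, 0). *)
have [y'0|y'0] := eqVneq y' 0.
  apply: (fourth 0); rewrite ?mulr0 //; move=> a0; apply: n10.
  by rewrite x'E y'0 a0 mulr0 addr0.
have [a0|a0] := eqVneq a 0.
  by apply: (third 0); rewrite ?mulr0 //; exact/eqP.
have ay0 : a / y' != 0 by rewrite mulf_neq0 ?invr_neq0.
have tN := t_neq0 F.
(* Either [a / y'] or [y' / (t a)] is integral, and it serves as the cofactor [z]. *)
case: (valring_total ay0) => Oz.
  by apply: third Oz _ _; [exact/eqP|rewrite mulrC divfK].
apply: fourth Oz _ _; first exact/eqP.
by rewrite mulrC invfM invf_div -!mulrA; field; rewrite tN a0.
Qed.

(** Whether [y] vanishes isolates the first piece. Among the other three, two distinct ones cannot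
    share [x]: after cancelling powers of [s], constant terms disagree. *)
Lemma shift_graph_fun x y x1 y1 x2 y2 :
  shift_graph x y x1 y1 -> shift_graph x y x2 y2 -> x1 = x2 /\ y1 = y2.
Proof.
have sI := mulfI s_neq0; have tI := mulfI (t_neq0 F).
case=> [[_ [y0 [-> ->]]]|[Oy [y0 H1]]].
  by case=> [[_ [_ [-> ->]]]|[_ []]].
case=> [[_ [/y0]]|[_ [_ H2]]] //.
case: H1 => [[u [/valring_near_power Ou [xE [-> ->]]]]|
  [[z [Oz [xE [-> ->]]]]|[z [Oz [xE [-> ->]]]]]]; rewrite {}xE in H2;
case: H2 => [[v [/valring_near_power Ov [E [-> ->]]]]|
  [[w [Ow [E [-> ->]]]]|[w [Ow [E [-> ->]]]]]].
- by move: E; rewrite expr2 -!mulrA => /sI ->.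
- by case: (@one_tM_neq_sM (s * u) w); rewrite // ?mulrA -?expr2 //; apply: valringM => //; exact: valring_s.
- by move: E; rewrite expr2 -mulrA => /sI /esym E; case: (@one_tM_neq_sM u w).
- by case: (@one_tM_neq_sM (s * v) z); rewrite // ?mulrA -?expr2 //; apply: valringM => //; exact: valring_s.
- by move/addrI/tI: E => ->.
- by case: (@one_tM_neq_sM (1 + t * w) z) => //; exact: valring_1tM.
- by move: E; rewrite expr2 -mulrA => /sI E; case: (@one_tM_neq_sM v z).
- by case: (@one_tM_neq_sM (1 + t * z) w) => //; exact: valring_1tM.
- by move/sI/addrI/tI: E => ->.
Qed.

Lemma shift_graph_inj x1 y1 x2 y2 x y :
  shift_graph x1 y1 x y -> shift_graph x2 y2 x y -> x1 = x2 /\ y1 = y2.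
Proof.
have sI := mulfI s_neq0; have tI := mulfI (t_neq0 F).
(* Only the last two pieces have images with [x'] in [1 + t O]. A common image would make each of
   [y4] and [y3 / t] an integral multiple of the other up to [t], giving [t * z4 * z3 = 1]. *)
have cross y3 y4 z3 z4 : O z3 -> O z4 -> y4 <> 0 ->
    y3 = t * (y4 * z4) -> 1 + t * (y3 * z3) = 1 + t * y4 -> False.
  move=> O3 O4 /eqP y40 -> /addrI/tI E; apply: (@tV_notin_valring F).
  suff -> : t^-1 = z4 * z3 by exact: valringM.
  apply: (mulfI (t_neq0 F)); apply: (mulfI y40); rewrite mulfV ?t_neq0 // mulr1.
  by rewrite -[LHS]E; ring.
case=> [[/valring_near_power O1 [-> [xE ->]]]|[O1 [y10 H1]]];
case=> [[/valring_near_power O2 [-> [E F2]]]|[O2 [y20 H2]]].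
- by move: E; rewrite xE => /sI ->.
- case: H2 => [[v [_ [_ [_ /esym/y20]]]]|[[w [_ [_ [_ /esym/y20]]]]|
    [w [_ [_ [E _]]]]]] //.
  by case: (@one_tM_neq_sM x1 y2); rewrite -?E.
- case: H1 => [[v [_ [_ [_ /esym]]]]|[[w [_ [_ [_ /esym]]]]|
    [w [_ [_ [E' _]]]]]]; rewrite ?F2 //.
  by case: (@one_tM_neq_sM x2 y1); rewrite -?E.
case: H1 => [[u [/valring_near_power Ou [-> [xE yE]]]]|
  [[z [Oz [-> [xE yE]]]]|[z [Oz [-> [xE yE]]]]]]; rewrite {}xE {}yE in H2;
case: H2 => [[v [/valring_near_power Ov [-> [E E']]]]|
  [[w [Ow [-> [E E']]]]|[w [Ow [-> [E E']]]]]].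
- by move/sI: E => ->.
- by case: (@one_tM_neq_sM u (y2 * w)) => //; exact: valringM.
- by case: (@one_tM_neq_sM u y2).
- by case: (@one_tM_neq_sM v (y1 * z)) => //; exact: valringM.
- by subst y2; move/addrI/tI/mulfI: E => -> //; exact/eqP.
- by case: (cross _ _ _ _ Oz Ow y20 E').
- by case: (@one_tM_neq_sM v y1).
- by case: (cross _ _ _ _ Ow Oz y10 (esym E')).
- move/addrI/tI: E => E; subst y2; move/tI/mulfI: E' => -> //; exact/eqP.
Qed.


(** * Transport of the shift to the valuation ring *)

Definition packed a := exists x, exists y, near_power x /\ O y /\ a = pack x y.

(* The shift transported to O by pack, extended by the identity, and translated
   by -1 so that the missing point pack 1 0 = 1 becomes 0. *)
Definition punctured_graph a b :=
  (exists x, exists y, exists x', exists y',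
     shift_graph x y x' y' /\ a = pack x y /\ b + 1 = pack x' y') \/
  (O a /\ ~ packed a /\ b + 1 = a).

Lemma pack10 : pack 1 0 = 1.
Proof. by rewrite /pack expr1n expr0n gtn_eqF ?mulr0 ?addr0 // ltnW. Qed.

Lemma packed_valring a : packed a -> O a.
Proof.
by move=> [x [y [Px [Oy ->]]]]; apply: valring_pack => //; exact: valring_near_power.
Qed.

Lemma packed1 : packed 1.
Proof.
exists 1, 0; rewrite pack10; split=> //.
by rewrite -[1]addr0 -[X in _ + X](mulr0 t); exact: near_power1.
Qed.

(** Both ends stay in the packed set, so the shift cannot collide with the identity on the
    complement. *)
Lemma shift_graph_packed x y x' y' : shift_graph x y x' y' ->
  packed (pack x y) /\ packed (pack x' y').
Proof. by move=> /shift_graph_sub[Px Oy Px' Oy' _]; split; [exists x, y|exists x', y']. Qed.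

(** The value [b = 0] stands for [pack 1 0 = 1]: the shift misses it, and the identity part avoids
    it because 1 is packed. *)
Lemma punctured_graph_sub a b : punctured_graph a b -> O a /\ (O `\ 0) b.
Proof.
have Ob : O (b + 1) -> O b.
  by move=> Ob1; rewrite -(addrK 1 b); apply/valringD/valringN/valring1.
case=> [[x [y [x' [y' [G [-> bE]]]]]]|[Oa [nPa bE]]].
  have [/packed_valring Oxy Pxy'] := shift_graph_packed G; split=> //; split.
    by apply: Ob; rewrite bE; exact: packed_valring.
  move=> /= b0; have [_ _ _ _] := shift_graph_sub G; apply; apply: pack_inj.
  by rewrite -bE b0 add0r pack10.
split=> //; split; first by apply: Ob; rewrite bE.
by move=> /= b0; apply: nPa; rewrite -bE b0 add0r; exact: packed1.
Qed.

Lemma punctured_graph_total a : O a -> exists b, punctured_graph a b.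
Proof.
move=> Oa; have [[x [y [Px [Oy ->]]]]|nPa] := pselect (packed a).
  have [x' [y' G]] := shift_graph_total Px Oy.
  by exists (pack x' y' - 1); left; exists x, y, x', y'; rewrite subrK.
by exists (a - 1); right; rewrite subrK.
Qed.

Lemma punctured_graph_onto b : (O `\ 0) b -> exists a, punctured_graph a b.
Proof.
move=> [Ob b0]; have [[x' [y' [Px' [Oy' bE]]]]|nPb] := pselect (packed (b + 1)).
  have [|x [y G]] := shift_graph_onto Px' Oy'.
    move=> [x'1 y'0]; apply: b0; apply: (addIr 1).
    by rewrite /= bE x'1 y'0 pack10 add0r.
  by exists (pack x y); left; exists x, y, x', y'.
by exists (b + 1); right; split=> //; exact/valringD/valring1.
Qed.

Lemma punctured_graph_fun a b b' :
  punctured_graph a b -> punctured_graph a b' -> b = b'.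
Proof.
move=> H H'; apply: (addIr 1); move: H H'.
case=> [[x [y [x' [y' [G [-> ->]]]]]]|[_ [nP ->]]].
  case=> [[x1 [y1 [x1' [y1' [G1 [/pack_inj[x1E y1E] ->]]]]]]|[_ [nP _]]].
    by subst x1 y1; have [-> ->] := shift_graph_fun G G1.
  by case: nP; have [] := shift_graph_packed G.
case=> [[x [y [x' [y' [G [aE _]]]]]]|[_ [_ ->]]] //.
by case: nP; rewrite aE; have [] := shift_graph_packed G.
Qed.

Lemma punctured_graph_inj a a' b :
  punctured_graph a b -> punctured_graph a' b -> a = a'.
Proof.
case=> [[x [y [x' [y' [G [-> bE]]]]]]|[_ [nP bE]]]; rewrite /punctured_graph bE.
  case=> [[x1 [y1 [x1' [y1' [G1 [-> /pack_inj[x1E y1E]]]]]]]|[_ [nP aE]]].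
    by subst x1' y1'; have [-> ->] := shift_graph_inj G G1.
  by case: nP; rewrite -aE; have [] := shift_graph_packed G.
case=> [[x [y [x' [y' [G [_ aE]]]]]]|[_ [_ ->]]] //.
by case: nP; rewrite aE; have [] := shift_graph_packed G.
Qed.

(** * Definability of the graph *)

Local Notation term_def := (term_def t).
Local Notation env_def := (env_def t).

Ltac prove_term := repeat first
  [ apply: term_add | apply: term_mul | apply: term_opp | apply: term_exp
  | exact: term_0 | exact: term_1 | exact: term_t | exact: term_var
  | assumption ].

Ltac prove_def := repeat first
  [ apply: def_and | apply: def_or | apply: def_not
  | (apply: def_exists; cbv beta) | (apply: def_eq; prove_term) ].

Lemma def_valring k (f : (nat -> L) -> L) :
  term_def k f -> env_def k (fun e => O (f e)).
Proof.
move=> df; have df1 := term_shift df; apply: (def_iff (fun e => iff_sym (valringE (f e)))).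
by prove_def.
Qed.

Lemma def_near_power k (f : (nat -> L) -> L) :
  term_def k f -> env_def k (fun e => near_power (f e)).
Proof.
move=> df; have df2 := term_shift (term_shift df); apply: (@def_iff _ _ _ (fun e => exists w, exists z,
    O w /\ ~ (w = 0) /\ O z /\ f e = w ^+ q.-1 * (1 + t * z))).
  move=> e; split=> -[w [z]]; first by case=> Ow [/eqP w0 [Oz E]]; exists w, z.
  by case=> Ow /eqP w0 Oz E; exists w, z.
by prove_def; apply def_valring; prove_term.
Qed.

Lemma def_punctured_graph : env_def 2 (fun e => punctured_graph (e 0) (e 1)).
Proof.
rewrite /punctured_graph /shift_graph /packed /pack /s.
by repeat first [apply def_near_power; prove_term | apply def_valring; prove_term |
  apply: def_and | apply: def_or | apply: def_not |
  (apply: def_exists; cbv beta) | (apply: def_eq; prove_term)].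
Qed.

Lemma valring_punctured : definably_bijective t
  [set x : 'rV[L]_1 | O (x 0 0)] [set x : 'rV[L]_1 | (O `\ 0) (x 0 0)].
Proof.
apply/definably_bijectiveP.
exists (fun u v => punctured_graph (u 0 0) (v 0 0)); split.
  apply: (env_def_definable def_punctured_graph) => z.
  have -> : env z 0 = @lsubmx _ 1 1 1 z 0 0 by rewrite mxE -envE.
  by have -> : env z 1 = @rsubmx _ 1 1 1 z 0 0 by rewrite mxE -envE.
have row1 (u v : 'rV[L]_1) : u 0 0 = v 0 0 -> u = v.
  by move=> E; apply/rowP => i; rewrite ord1.
split=> [u v /punctured_graph_sub //|u /punctured_graph_total[b H]|
  v /punctured_graph_onto[a H]|u v v' H H'|u u' v H H'].
- by exists (const_mx b); rewrite mxE.
- by exists (const_mx a); rewrite mxE.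
- exact/row1/(punctured_graph_fun H H').
- exact/row1/(punctured_graph_inj H H').
Qed.

End FiniteResidueField.

(** * Collapse of the Grothendieck ring *)

Lemma K0_eq0_of_punctured (K : comNzRingType) (t : K) n (n_gt0 : (0 < n)%N)
    (X Y : set 'rV[K]_n) (a : 'rV[K]_n) :
  definable t X -> definable t Y -> X = Y `|` [set a] -> ~ Y a ->
  definably_bijective t X Y -> forall z : K0 t, z = 0.
Proof.
move=> dX dY XE nYa XY.
have da : definable t [set a].
  rewrite (_ : [set a] = X `&` ~` Y); first exact/definableI/definableC.
  rewrite XE; apply/seteqP; split=> [_ ->|u [[]//]]; first by split; [right|].
have XYE : gclass n_gt0 dX = gclass n_gt0 dY by congr << _ >>; apply/defclassP.
have aE : gclass n_gt0 da = 1.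
  rewrite -[RHS]/(<< defclass_one t >>); congr << _ >>.
  exact: (@defclass_point _ _ (Defset n_gt0 da) a).
have d0 : definable t (Y `&` [set a]) by exact: definableI.
have Ya0 : Y `&` [set a] = set0 by apply/seteqP; split=> // u [Yu ua]; apply: nYa; rewrite -ua.
have S0 : gclass n_gt0 (definable0 t n) \in scissor_group (t:=t).
  exact/asboolP/scissor_span_gen/scissor_set0.
have S1 : (1 : monalg.malg (defclass t) int) \in scissor_group (t:=t).
  (* The relation for [X = Y + {a}] reads [[Y] + 1 - ([X] + [set0])]. As [[X] = [Y]], it reduces to
     [1 - [set0]], and adding the relation [[set0]] leaves 1. *)
  have := scissor_span_gen (scissor_setUI_eq n_gt0 n_gt0 n_gt0 n_gt0 dY da dX d0 XE erefl).
  move/asboolP; rewrite XYE aE (eq_gclass n_gt0 n_gt0 d0 (definable0 t n) Ya0).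
  by rewrite opprD addrACA subrr add0r => /(rpredD S0); rewrite addrCA subrr addr0.
(* The relations form an ideal, which now contains 1. *)
move=> z; rewrite -[z]reprK (_ : 0 = \pi_(K0 t)%qT 0); last by rewrite !piE.
apply/pi_K0E.
by rewrite subr0 -[repr z]mulr1; exact: scissor_group_ideal.
Qed.

Theorem theorem5 (F : finFieldType) :
  (forall x : K0 (laurent_t F), x = 0) /\
  (exists f : 'rV[laurent F]_1 -> 'rV[laurent F]_1,
     definable_bijection (laurent_t F)
       [set x : 'rV[laurent F]_1 | valring F (x 0 0)]
       [set x : 'rV[laurent F]_1 | (valring F `\ 0) (x 0 0)] f).
Proof.
split; last exact: valring_punctured.
have dO : definable (laurent_t F) [set x : 'rV[laurent F]_1 | valring F (x 0 0)].
  apply: (env_def_definable (def_valring (term_var (laurent_t F) (ltnSn 0)))) => x.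
  by have -> : env x 0 = x 0 0 by exact: (envE x 0).
have dO0 : definable (laurent_t F)
    [set x : 'rV[laurent F]_1 | (valring F `\ 0) (x 0 0)].
  have := definableI dO (definableC (definable_zero (laurent_t F) 1)).
  congr definable; apply/seteqP; split=> x /= [Ox x0]; split=> // x00; apply: x0.
    by apply/rowP => i; rewrite mxE ord1.
  by rewrite x00 mxE.
apply: (K0_eq0_of_punctured (ltnSn 0) dO dO0 _ _ (@valring_punctured F) (a := 0)).
  apply/seteqP; split=> x /=; last by move=> [[]|->] //; rewrite mxE.
  move=> Ox; have [x0|x0] := pselect (x = 0); [by right|left; split=> // x00].
  by apply: x0; apply/rowP => i; rewrite mxE ord1.
by move=> /= [_]; apply; rewrite mxE.
Qed.
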